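(* Let $\gamma\in\mathbb{C}$ with $|\gamma|=1$ be an algebraic number which is not a root of unity. Then for every function $\psi\colon\mathbb{Z}_+\to\mathbb{Z}_+$ with $\psi(n)\to\infty$ as $n\to\infty$ and every $\varepsilon>0$, there is an $n_0$ such that for every $n\ge n_0$ and every $n$th root of unity $\omega$ we have $$\operatorname{dist}(\gamma,\omega)\ge e^{-\varepsilon\psi(n)n}.$$
   Context: $\mathbb{Z}_+=\{0,1,2,\dots\}$, and $\operatorname{dist}$ is the usual distance on the unit circle $\{z\in\mathbb{C}:|z|=1\}$. *)

(* Defs.v *)
From mathcomp Require Import all_boot all_order all_algebra.
From mathcomp Require Import all_classical all_reals all_analysis.
From mathcomp Require Import complex.
Set Implicit Arguments.
Unset Strict Implicit.
Unset Printing Implicit Defensive.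

(* The Euclidean (chordal) distance, i.e. the metric of the complex plane
   restricted to the unit circle.  The arc length distance d satisfies
   circle_dist <= d <= pi / 2 * circle_dist there, so a lower bound for
   circle_dist is also one for d. *)
Definition circle_dist (R : realType) (z w : complex R) : R :=
  ComplexField.Normc.normc (z - w)%R.

(* Main.v *)
Require Import Defs.
From mathcomp Require Import all_boot all_order all_algebra.
From mathcomp Require Import all_classical all_reals all_analysis.
From mathcomp Require Import complex.
Set Implicit Arguments.
Unset Strict Implicit.
Unset Printing Implicit Defensive.
Import Order.TTheory GRing.Theory Num.Theory.
Import numFieldNormedType.Exports.
Local Open Scope classical_set_scope.
Local Open Scope ring_scope.

(* A Liouville-type argument. Let d be the degree of gamma over the rationals
   and v the column of the powers of gamma below d. Multiplication by gamma acts
   on v through a rational matrix, hence N v = a gamma v for some integer matrix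
   N and integer a > 0. The integer matrix M = N^n - a^n satisfies
   M v = a^n (gamma^n - 1) v; its determinant is not 0, since a left kernel
   vector would be a linear relation between the entries of v. Multiplying
   M v = a^n (gamma^n - 1) v by the adjugate of M, whose entries are at most
   exponential in n, gives |gamma^n - 1| >= C^(-n). Finally
   |gamma^n - 1| = |gamma^n - omega^n| <= n |gamma - omega|, and psi(n) -> oo
   makes exp(- eps psi(n) n) smaller than any (2C)^(-n). *)

Definition powers_col (K : pzRingType) d (g : K) : 'cV[K]_d := \col_i g ^+ i.

Lemma mulmx_powers_col (K : nzRingType) d (g : K) (w : 'rV[K]_d) :
  w *m powers_col d g = (rVpoly w).[g]%:M.
Proof.
apply/matrixP=> i j; rewrite !ord1 !mxE mulr1n horner_poly.
by apply: eq_bigr => k _; rewrite mxE insubT //= => lt_kd;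
  congr (w _ _ * _); apply: val_inj.
Qed.

(** Take an annihilating polynomial [p] of least size. Reduction modulo [p] does not change values
    at [g], which gives [A]; a nontrivial relation among the powers of [g] would be a smaller
    annihilating polynomial. *)
Lemma exists_rat_companion (K : numFieldType) (g : K) :
    algebraicOver (ratr : rat -> K) g ->
  exists d (A : 'M[rat]_d.+1),
    map_mx ratr A *m powers_col d.+1 g = g *: powers_col d.+1 g /\
    forall w : 'rV[rat]_d.+1, map_mx ratr w *m powers_col d.+1 g = 0 -> w = 0.
Proof.
case=> p; have [m] := ubnP (size p); elim: m p => // m IHm p lt_pm p_neq0 pg0.
have [[q [q_neq0 lt_qp qg0]]|minp] := EM (exists q : {poly rat},
    [/\ q != 0, (size q < size p)%N & root (map_poly (ratr : rat -> K) q) g]).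
  by apply: (IHm q) => //; apply: leq_trans lt_qp _.
have size_p_gt1 : (1 < size p)%N.
  rewrite ltnNge; apply/negP => /size1_polyC p_const.
  move: pg0 p_neq0; rewrite p_const map_polyC /root hornerC polyC_eq0 /=.
  by rewrite fmorph_eq0 => ->.
case def_d: (size p) size_p_gt1 => [|[|d]] // _.
have evalE (w : 'rV[rat]_d.+1) :
    map_mx ratr w *m powers_col d.+1 g = (map_poly ratr (rVpoly w)).[g]%:M.
  by rewrite mulmx_powers_col map_rVpoly.
(* Row [i] holds the coefficients of the remainder of [X^(i+1)], whose value at [g] is [g * g^i]. As
   [size p] is [d.+2], remainders fit in [d.+1] coefficients. *)
exists d, (\matrix_i poly_rV ('X^(i.+1) %% p)); split=> [|w wg0].
  apply/row_matrixP => i; rewrite row_mul -map_row rowK evalE poly_rV_K; last first.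
    by rewrite -ltnS -def_d ltn_modp.
  apply/matrixP=> k j; rewrite !ord1 !mxE mulr1n -exprS.
  have: map_poly (ratr : rat -> K) 'X^(i.+1) =
        map_poly ratr ('X^(i.+1) %/ p * p + 'X^(i.+1) %% p).
    by rewrite -divp_eq.
  move/(congr1 (horner^~ g)); rewrite map_polyXn hornerXn.
  by rewrite rmorphD rmorphM hornerD hornerM /= (rootP pg0) mulr0 add0r => ->.
apply: contra_notP minp => /eqP w_neq0; exists (rVpoly w); split.
- by apply: contra_neq w_neq0 => w0; rewrite -[w]rVpolyK w0 linear0.
- by rewrite def_d ltnS size_poly.
- apply/rootP; move: wg0; rewrite evalE => /matrixP/(_ 0 0).
  by rewrite !mxE mulr1n.
Qed.

Lemma exists_int_multiple m n (A : 'M[rat]_(m, n)) :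
  exists2 a : nat, (0 < a)%N &
  exists N : 'M[int]_(m, n), map_mx intr N = a%:R *: A.
Proof.
pose a := (\prod_(k : 'I_m * 'I_n) `|denq (A k.1 k.2)|)%N.
exists a; first by rewrite prodn_gt0 // => k; rewrite absz_gt0 denq_neq0.
exists (\matrix_(i, j) numq (a%:R * A i j)); apply/matrixP=> i j; rewrite !mxE.
rewrite numqK // /a (bigD1 (i, j)) //= natrM mulrAC rpredM ?rpred_nat //.
by rewrite natr_absz normr_denq mulrC -numqE rpred_int.
Qed.

Lemma ler_norm_det (R : numDomainType) n (M : 'M[R]_n) (B : R) :
  (forall i j, `|M i j| <= B) -> `|\det M| <= n`!%:R * B ^+ n.
Proof.
move=> M_le; apply: le_trans (ler_norm_sum _ _ _) _.
rewrite -perm.card_Sn mulr_natl -sumr_const.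
apply: ler_sum => s _; rewrite normrMsign normr_prod.
rewrite -[X in _ <= _ ^+ X](card_ord n) -prodr_const.
by apply: ler_prod => i _; rewrite normr_ge0 M_le.
Qed.

(** Each further factor [M] turns an entry into a sum of [n.+1] products, which costs a factor
    [n.+1] besides [B]. *)
Lemma ler_norm_mxX (R : numDomainType) n (M : 'M[R]_n.+1) (B : R) k :
  0 <= B -> (forall i j, `|M i j| <= B) ->
  forall i j, `|(M ^+ k) i j| <= (n.+1%:R * B) ^+ k.
Proof.
move=> B_ge0 M_le; elim: k => [|k IHk] i j.
  by rewrite !expr0 mxE; case: eqP; rewrite ?normr1 ?normr0.
rewrite exprS mxE; apply: le_trans (ler_norm_sum _ _ _) _.
rewrite exprS -mulrA mulr_natl -[X in _ *+ X]card_ord -sumr_const.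
by apply: ler_sum => l _; rewrite normrM ler_pM.
Qed.

Lemma powers_sub1_lower_bound (K : numFieldType) (g : K) :
    `|g| <= 1 -> algebraicOver (ratr : rat -> K) g ->
  exists C : nat, forall n, (0 < n)%N -> g ^+ n != 1 -> 1 <= C%:R ^+ n * `|g ^+ n - 1|.
Proof.
move=> g_le1 /exists_rat_companion[d [A [eigA freev]]].
have [a a_gt0 [N defN]] := exists_int_multiple A.
set v := powers_col d.+1 g in eigA freev.
pose NK : 'M[K]_d.+1 := map_mx intr N.
have NKA : NK = a%:R *: map_mx ratr A.
  apply/matrixP=> i j; move/matrixP/(_ i j)/(congr1 (ratr : rat -> K)): defN.
  by rewrite !mxE rmorphM /= ratr_int ratr_nat.
have NKv n : NK ^+ n *m v = (a%:R * g) ^+ n *: v.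
  elim: n => [|n IHn]; first by rewrite !expr0 mul1mx scale1r.
  rewrite exprS -mulmxA IHn -scalemxAr NKA -scalemxAl eigA !scalerA exprSr.
  by rewrite !mulrA.
have [B NK_le] : exists B : nat, forall i j, `|NK i j| <= B%:R.
  exists (\sum_i \sum_j `|N i j|)%N => i j; rewrite mxE -intr_norm -natr_absz.
  by rewrite ler_nat (bigD1 i) //= (bigD1 j) //= -addnA leq_addr.
(* Entries of [NK ^+ n] are at most [(d.+1 * B)^n] and the diagonal shift is [a^n]; since [n > 0],
   the 2 from adding them is absorbed into [2^n]. *)
pose D := (2 * (d.+1 * B + a))%N.
(* The sum for an entry of [\adj MK *m v] has [d.+1] terms, each cofactor is at most [d! * (D^n)^d],
   and [a^n] comes from [s]. *)
exists (d.+1 * d`! * D ^ d * a)%N.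
move=> n n_gt0 gn_neq1.
pose M : 'M[int]_d.+1 := N ^+ n - (a%:R ^+ n)%:M.
pose MK : 'M[K]_d.+1 := NK ^+ n - (a%:R ^+ n)%:M.
have ME (F : numFieldType) :
    map_mx (intr : int -> F) M = map_mx intr N ^+ n - (a%:R ^+ n)%:M.
  by rewrite map_mxB map_scalar_mx rmorphXn /= rmorphXn /= rmorph_nat.
have a_n_neq0 : (a%:R ^+ n : K) != 0 by rewrite expf_neq0 // pnatr_eq0 -lt0n.
pose s : K := a%:R ^+ n * (g ^+ n - 1).
have s_neq0 : s != 0 by rewrite mulf_neq0 // subr_eq0.
have MKv : MK *m v = s *: v.
  by rewrite mulmxBl NKv mul_scalar_mx -scalerBl exprMn /s mulrBr mulr1.
have detM : 1 <= `|\det MK|.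
  have -> : \det MK = (\det M)%:~R by rewrite -det_map_mx ME.
  rewrite -intr_norm ler1z -gtz0_ge1 normr_gt0.
  apply/negP => /eqP detM0.
  (* The kernel vector is taken over [rat], because [freev] excludes only rational relations. *)
  have /det0P[w w_neq0 wM0] : \det (map_mx (intr : int -> rat) M) == 0.
    by rewrite det_map_mx detM0.
  case/eqP: w_neq0; apply: freev; apply/eqP.
  have: map_mx ratr w *m MK *m v = 0.
    suff -> : MK = map_mx ratr (map_mx (intr : int -> rat) M).
      by rewrite -map_mxM wM0 map_mx0 mul0mx.
    rewrite /MK -ME -map_mx_comp; apply/matrixP=> i j; rewrite !mxE.
    by rewrite /= ratr_int.
  rewrite -mulmxA MKv -scalemxAr => /eqP; rewrite scaler_eq0.
  by rewrite (negPf s_neq0).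
have MK_le i j : `|MK i j| <= D%:R ^+ n.
  have a_le : (a%:R : K) <= (d.+1 * B + a)%:R by rewrite ler_nat leq_addl.
  have b_le : (d.+1%:R * B%:R : K) <= (d.+1 * B + a)%:R
    by rewrite -natrM ler_nat leq_addr.
  rewrite /D natrM exprMn.
  apply: (@le_trans _ _ (2 * (d.+1 * B + a)%:R ^+ n)); last first.
    by rewrite ler_wpM2r ?exprn_ge0 ?ler0n// -{1}[2]expr1 ler_eXn2l ?ltr1n.
  rewrite !mxE mulr_natl mulr2n (le_trans (ler_normB _ _)) // lerD //.
    apply: le_trans (ler_norm_mxX _ _ NK_le _ _) _; first exact: ler0n.
    by rewrite lerXn2r // ?nnegrE ?mulr_ge0 ?ler0n.
  case: (i == j); rewrite ?normr0 ?exprn_ge0 ?ler0n //.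
  by rewrite mulr1n normrX ger0_norm ?ler0n // lerXn2r // nnegrE ler0n.
(* Compare the entries of index 0 in [\adj MK *m MK *m v = \det MK *: v]; there [v] has the entry
   [g^0 = 1]. *)
have detE : \det MK = s * \sum_j \adj MK 0 j * v j 0.
  have := congr1 (fun X => (X *m v) 0 0) (mul_adj_mx MK).
  rewrite mul_scalar_mx -mulmxA MKv -scalemxAr.
  by rewrite ![in LHS]mxE => ->; rewrite !mxE expr0 mulr1.
apply: le_trans detM _; rewrite detE normrM /s normrM mulrC normrX normr_nat.
rewrite mulrA ler_wpM2r ?normr_ge0 // natrM exprMn ler_wpM2r ?exprn_ge0 ?ler0n //.
apply: le_trans (ler_norm_sum _ _ _) _.
have adj_le j : `|\adj MK 0 j * v j 0| <= (d`! * D ^ d)%:R ^+ n.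
  rewrite normrM !mxE normrX -[leRHS]mulr1 ler_pM ?exprn_ge0 ?normr_ge0 //; last first.
    by rewrite exprn_ile1 ?normr_ge0.
  rewrite normrMsign.
  apply: le_trans (ler_norm_det (B := D%:R ^+ n) _) _ => [i k|].
    by rewrite 2!mxE; apply: MK_le.
  rewrite /= natrM exprMn natrX exprAC ler_wpM2r ?exprn_ge0 ?ler0n //.
  by rewrite -{1}[_%:R]expr1 ler_weXn2l ?ler1n ?fact_gt0.
apply: le_trans (ler_sum _ (fun j _ => adj_le j)) _.
rewrite sumr_const card_ord -mulnA [in leRHS]natrM [in leRHS]exprMn.
rewrite -[leLHS]mulr_natl ler_wpM2r ?exprn_ge0 ?ler0n //.
by rewrite -{1}[_%:R]expr1 ler_weXn2l ?ler1n.
Qed.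

Lemma ler_norm_subXX (K : numDomainType) (x y : K) n :
  `|x| <= 1 -> `|y| <= 1 -> `|x ^+ n - y ^+ n| <= n%:R * `|x - y|.
Proof.
move=> x_le1 y_le1; rewrite subrXX normrM mulrC ler_wpM2r ?normr_ge0 //.
apply: le_trans (ler_norm_sum _ _ _) _.
rewrite -[X in _ <= X%:R]card_ord -sumr_const ler_sum // => i _.
by rewrite normrM !normrX mulr_ile1 ?exprn_ge0 ?normr_ge0 ?exprn_ile1.
Qed.

Theorem corollary7p5 (R : realType) (gamma : R[i])
  (gamma_circle : `|gamma| = 1)
  (gamma_alg : algebraicOver (ratr : rat -> R[i]) gamma)
  (gamma_not_unity : forall m : nat, (0 < m)%N -> ~~ m.-unity_root gamma)
  (psi : nat -> nat) (psi_infty : psi n @[n --> \oo] --> \oo)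
  (eps : R) (eps_gt0 : 0 < eps) :
  exists n0 : nat, forall n : nat, (0 < n)%N -> (n0 <= n)%N ->
    forall omega : R[i], n.-unity_root omega ->
      expR (- (eps * (psi n)%:R * n%:R)) <= circle_dist gamma omega.
Proof.
have gamma_le1 : `|gamma| <= 1 by rewrite gamma_circle.
have [C gammaC] := powers_sub1_lower_bound gamma_le1 gamma_alg.
(* Beyond this threshold [eps * psi n >= 2 * C]. *)
have /cvgnyPge/(_ (Num.bound ((2 * C)%:R / eps)))[n0 _ psi_ge] := psi_infty.
exists n0 => n n_gt0 le_n0n omega; rewrite unity_rootE => /eqP omega_n.
have omega_le1 : `|omega| <= 1.
  by rewrite -(@expr_le1 _ n) // -normrX omega_n normr1.
(* The factor [n] lost in passing from [n]th powers to [gamma - omega] is bounded by [2^n], hence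
   the base [2 * C]. *)
have dist_ge : 1 <= (2 * C)%:R ^+ n * circle_dist gamma omega.
  rewrite -lecR rmorphM rmorphXn /= rmorph_nat rmorph1.
  apply: le_trans (gammaC n n_gt0 _) _.
    by rewrite -unity_rootE gamma_not_unity.
  rewrite mulnC natrM exprMn -mulrA ler_wpM2l ?exprn_ge0 ?ler0n //.
  rewrite -[X in gamma ^+ n - X]omega_n.
  apply: le_trans (ler_norm_subXX _ gamma_le1 omega_le1) _.
  by rewrite ler_wpM2r ?normr_ge0 // -natrX ler_nat; apply/ltnW/ltn_expl.
have C_le : (2 * C)%:R <= expR (eps * (psi n)%:R).
  have eps_psi : (2 * C)%:R <= eps * (psi n)%:R.
    rewrite -ler_pdivrMl // mulrC (le_trans (ler_norm _)) //.
    by apply: le_trans (ltW (truncnS_gt _)) _; rewrite ler_nat; apply: psi_ge.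
  by apply: le_trans (expR_ge1Dx _); rewrite (le_trans eps_psi) // lerDr.
rewrite expRN expRM_natr -[leLHS]mul1r ler_pdivrMr ?exprn_gt0 ?expR_gt0 // mulrC.
apply: le_trans dist_ge _; rewrite ler_wpM2r //; last first.
  by rewrite lerXn2r ?nnegrE ?ler0n ?expR_ge0.
by rewrite -lecR rmorph0; exact: (normr_ge0 (gamma - omega)).
Qed.
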